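(* Let $n$ be an odd integer and $k>2$ an even integer with $n>2k$, and let $r$ be the remainder of $n$ modulo $2k$ (so $0\le r<2k$). Then $$\alpha(P(n,k)) \geq (2k-1)\left\lfloor\frac{n}{2k}\right\rfloor + \begin{cases} -\frac{k}{2}+2 & \text{if } r=1,\\[2pt] \frac{3r-k-1}{2} & \text{if } 1<r<k,\\[2pt] \frac{k}{2}+\frac{r-1}{2} & \text{if } k<r<2k.\end{cases}$$
   Context: For positive integers $n,k$ with $n>2k$, the generalized Petersen graph $P(n,k)$ is the graph with vertex set $\{u_i,v_i : i=1,\dots,n\}$ (so $2n$ vertices) and edge set $\{u_iu_{i+1},\ u_iv_i,\ v_iv_{i+k} : i=1,\dots,n\}$, subscripts being reduced modulo $n$. For a graph $G$, $\alpha(G)$ denotes the independence number, i.e. the size of a largest set of pairwise non-adjacent vertices. *)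

(* Defs.v *)
From mathcomp Require Import all_boot all_order all_algebra.

Set Implicit Arguments.
Unset Strict Implicit.
Unset Printing Implicit Defensive.

Section Independence.
Variables (V : finType) (e : rel V).

(* The diagonal x = y imposes nothing when e is irreflexive. *)
Definition independent (S : {set V}) : bool :=
  [forall x in S, forall y in S, ~~ e x y].

Definition indep_num : nat := \max_(S : {set V} | independent S) #|S|.

End Independence.

(* The vertices u_i and v_i are inl i and inr i; subscripts are the residues
   0, ..., n-1 rather than 1, ..., n. *)
Definition petersen_vertex (n : nat) : finType := ('I_n + 'I_n)%type.

Definition petersen_arc (n k : nat) : rel (petersen_vertex n) :=
  fun x y => match x, y with
  | inl i, inl j => val j == (i + 1) %% n
  | inl i, inr j => j == i
  | inr i, inr j => val j == (i + k) %% n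
  | inr _, inl _ => false
  end.

Definition petersen (n k : nat) : rel (petersen_vertex n) :=
  fun x y => petersen_arc k x y || petersen_arc k y x.

Lemma petersen_sym n k : symmetric (@petersen n k).
Proof. by move=> x y; rewrite /petersen orbC. Qed.

Lemma petersen_irrefl n k : 0 < k -> 2 * k < n -> irreflexive (@petersen n k).
Proof.
move=> k0 kn.
have shift d (i : 'I_n) : 0 < d < n -> (val i == (i + d) %% n) = false.
  case/andP=> d0 dn; apply/negbTE/eqP => ii.
  have: i + 0 == i + d %[mod n] by rewrite addn0 modn_small // -ii.
  by rewrite eqn_modDl mod0n modn_small // eq_sym -leqn0 leqNgt d0.
have kn' : k < n by apply: leq_ltn_trans kn; rewrite leq_pmull.
have n1 : 1 < n by apply: leq_ltn_trans kn'.
by case=> i; rewrite /petersen /= orbb shift // ?k0.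
Qed.

(* Main.v *)
Require Import Defs.
From mathcomp Require Import all_boot all_order all_algebra.
From mathcomp Require Import zify lra.
Import Order.TTheory GRing.Theory Num.Theory.
Local Open Scope ring_scope.

(** Cut the subscripts 0, ..., n-1 into intervals of length k, alternately low
    and high.  Where possible, take u_p for even p and v_p for odd p in the low
    intervals, and v_p for even p and u_p for odd p in the high ones.  The only
    conflicts are between u_p and u_(p+1) at the end of a block of length 2k, and
    those created by the wrap-around.  They disappear if neither u_p nor v_p is
    taken for the last p of each full block, for the even high p among the last k
    subscripts, and for p = n-1 when this subscript is low.  If r = 1, then u_p
    can be restored at the end p = n-2 of the last full block. *)

Definition low (k p : nat) : bool := (p %% (2 * k) < k)%N.

(** As [n] is odd, [n - 1] is even, so [p.+1 < n] drops u_(n-1) just when this subscript is low; it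
    would meet u_0. A block end with [p.+2 == n] exists only for r = 1. *)
Definition takes_u (n k p : nat) : bool :=
  [&& odd p != low k p, (p.+1 < n)%N & (2 * k %| p.+1)%N ==> (p.+2 == n)].

Definition takes_v (n k p : nat) : bool :=
  (odd p == low k p) && (low k p || (p + k < n)%N).

Definition chosen (n k : nat) : {set petersen_vertex n} :=
  [set x : 'I_n + 'I_n |
    match x with inl i => takes_u n k i | inr i => takes_v n k i end].

Lemma low_addk k p : (0 < k)%N -> low k (p + k) = ~~ low k p.
Proof.
move=> k0; rewrite /low -modnDml.
have: (p %% (2 * k) < 2 * k)%N by rewrite ltn_mod; lia.
move: (p %% _)%N => s sk; have [sk'|ks] := ltnP s k.
  by rewrite modn_small; lia.
by rewrite (_ : s + k = s - k + 2 * k)%N ?modnDr ?modn_small; lia.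
Qed.

Lemma low_succ_dvd k p : ~~ low k p -> low k p.+1 -> (2 * k %| p.+1)%N.
Proof. by rewrite /low modnS; case: ifP => //; lia. Qed.

Lemma low_even_succ k p : ~~ odd k -> ~~ odd p -> low k p -> low k p.+1.
Proof.
move=> k_even p_even; rewrite /low modnS; case: ifP => [_|_]; first by lia.
have: odd (p %% (2 * k)) = odd p by rewrite odd_mod // oddM.
by lia.
Qed.

(** Parity flips from p to p+1, so lowness would have to flip too. An even low p cannot end its
    interval, as [k] is even; an odd high p ends a block, and is then kept only if p+1 = n-1, where
    u is dropped. *)
Lemma takes_u_succ n k p :
  ~~ odd k -> takes_u n k p -> ~~ takes_u n k p.+1.
Proof.
move=> k_even /and3P[up pn /implyP up']; apply/negP => /and3P[us spn _].
have pe := @low_even_succ k p k_even; have po := @low_succ_dvd k p.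
move: up us up' pe po => /=; case: (odd p) (low k p) (low k p.+1) => [] [] [] //=.
- by move=> _ _ up _ po; move: up; rewrite po // => /(_ isT); lia.
by move=> _ _ _ /(_ isT isT).
Qed.

(** Without wrap-around, adding [k] keeps parity and flips lowness. With it, p must be low, hence
    odd, and p+k-n is even and below [k], hence low. *)
Lemma takes_v_shift n k p : odd n -> (0 < k)%N -> ~~ odd k -> (k < n)%N ->
  (p < n)%N -> takes_v n k p -> ~~ takes_v n k ((p + k) %% n).
Proof.
move=> n_odd k0 k_even kn pn /andP[/eqP vp]; have [pkn _|npk] := ltnP (p + k) n.
  rewrite modn_small // /takes_v low_addk // oddD vp (negbTE k_even) addbF.
  by case: (low k p).
rewrite orbF => lp.
have -> : ((p + k) %% n = p + k - n)%N.
  by rewrite -[in LHS](subnK npk) modnDr modn_small; lia.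
have lw : low k (p + k - n) by rewrite /low modn_small; lia.
by rewrite /takes_v lw; move: vp; rewrite lp; lia.
Qed.

Lemma chosen_independent n k : odd n -> (0 < k)%N -> ~~ odd k -> (k < n)%N ->
  independent (@petersen n k) (chosen n k).
Proof.
move=> n_odd k0 k_even kn.
have arcN x y : x \in chosen n k -> y \in chosen n k -> ~~ petersen_arc k x y.
  rewrite !inE; case: x y => i [j|j] //= ci cj; apply/negP => /eqP ji.
  - have /and3P[_ sin _] := ci; move: cj.
    by rewrite ji addn1 modn_small // (negbTE (takes_u_succ _ _ _ k_even ci)).
  - by case/and3P: ci; move: cj; rewrite ji => /andP[/eqP->]; rewrite eqxx.
  - by move: cj; rewrite ji (negbTE (takes_v_shift _ _ _ _ _ _ _ _ ci)).
apply/forall_inP => x cx; apply/forall_inP => y cy.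
by rewrite /petersen negb_or !arcN.
Qed.

Lemma card_chosen n k :
  #|chosen n k| = (\sum_(0 <= p < n) (takes_u n k p + takes_v n k p))%N.
Proof.
by rewrite -sum1dep_card big_mkcond big_sumType /= big_split /= !big_mkord.
Qed.

Lemma sum_even_itv a b n :
  (\sum_(0 <= p < n) ((a <= p < b) && ~~ odd p) <=
   (minn n b - a + ~~ odd a)./2)%N.
Proof.
elim: n => [|n IHn]; first by rewrite big_geq.
by rewrite big_nat_recr //=; lia.
Qed.

Lemma sum_dvd_succ d n : (\sum_(0 <= p < n) (d %| p.+1) = n %/ d)%N.
Proof. by rewrite divn_count_dvd big_add1. Qed.

Lemma sum_eq_nat (b : bool) c n : (c < n)%N ->
  (\sum_(0 <= p < n) (b && (p == c)) = b)%N.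
Proof.
suff -> : (\sum_(0 <= p < n) (b && (p == c)) = b && (c < n))%N.
  by move=> ->; rewrite andbT.
elim: n => [|n IHn]; first by rewrite big_geq // ltn0 andbF.
by rewrite big_nat_recr //= IHn; lia.
Qed.

Lemma modn_eq_sub d q p : (q * d <= p < q.+1 * d)%N -> (p %% d = p - q * d)%N.
Proof.
by case/andP=> qp pq; rewrite -{1}(subnKC qp) modnMDl modn_small //; lia.
Qed.

(** The truncated differences add up to |k-r|, which is odd. The high subscripts among the last [k]
    form an interval of this length, starting at the odd [n - k] if r < k and at an even number if r
    > k. The term [low k n] accounts for the loss at [n - 1]. *)
Lemma sum_high_even_tail n k (r := (n %% (2 * k))%N) :
    odd n -> ~~ odd k -> (0 < k < n)%N ->
  (\sum_(0 <= p < n) [&& (n <= p + k)%N, ~~ low k p & ~~ odd p] + low k n <=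
   ((k - r) + (r - k)).+1./2)%N.
Proof.
move=> n_odd k_even /andP[k0 kn].
have nE : n = (n %/ (2 * k) * (2 * k) + r)%N by rewrite -divn_eq.
have r_lt : (r < 2 * k)%N by rewrite ltn_mod; lia.
have r_odd : odd r by rewrite odd_mod // oddM.
move: nE; set q := (n %/ _)%N => nE.
have qE : odd (q * (2 * k)) = false by rewrite !oddM andbF.
have mod_tail p : (q * (2 * k) <= p < n)%N -> (p %% (2 * k) = p - q * (2 * k))%N.
  by move=> pq; apply: modn_eq_sub; rewrite mulSn; lia.
rewrite {2}/low -/r; move: (q * _)%N mod_tail nE qE => Q mod_tail nE Q_even.
clearbody r; clear q; have [rk|kr] := ltnP r k.
  suff le_tail : (\sum_(0 <= p < n) [&& (n <= p + k)%N, ~~ low k p & ~~ odd p] <=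
    \sum_(0 <= p < n) ((n - k <= p < Q) && ~~ odd p))%N.
    have := leq_trans le_tail (sum_even_itv _ _ _); lia.
  rewrite big_nat_cond [X in (_ <= X)%N]big_nat_cond; apply: leq_sum => p /andP[pn _].
  move: (mod_tail p); rewrite /low; move: (p %% _)%N => s; lia.
suff le_tail : (\sum_(0 <= p < n) [&& (n <= p + k)%N, ~~ low k p & ~~ odd p] <=
    \sum_(0 <= p < n) ((Q + k <= p < n) && ~~ odd p))%N.
  have := leq_trans le_tail (sum_even_itv _ _ _); lia.
rewrite big_nat_cond [X in (_ <= X)%N]big_nat_cond; apply: leq_sum => p /andP[pn _].
move: (mod_tail p); rewrite /low; move: (p %% _)%N => s; lia.
Qed.

(* The left-hand side is 2 at the restored u_(n-2), which the term counting the
   ends of blocks on the right counts as lost. *)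
Lemma chosen_or_lost n k p : odd n -> (1 < n)%N -> (0 < k)%N -> ~~ odd k ->
    (p < n)%N ->
  (1 + ((n %% (2 * k) == 1) && (p == n - 2)) <=
   takes_u n k p + takes_v n k p + (2 * k %| p.+1) +
   [&& n <= p + k, ~~ low k p & ~~ odd p] + (low k n && (p == n.-1)))%N.
Proof.
move=> n_odd n1 k0 k_even pn; rewrite /takes_u /takes_v.
have pe : ~~ odd p -> low k p -> low k p.+1 by apply: low_even_succ.
case: (altP andP) => [[/eqP r1 /eqP pE]|_].
  have d : (2 * k %| p.+1)%N.
    have := dvdn_mull (n %/ (2 * k)) (dvdnn (2 * k)).
    move: (divn_eq n (2 * k)); rewrite r1; move: (_ %/ _ * _)%N => m nE.
    by rewrite (_ : m = p.+1) //; lia.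
  have hp : low k p = false.
    apply/negP => lp; move: lp d; rewrite /low /dvdn -(addn1 p) -modnDml => lp.
    by rewrite modn_small ?addn1 //; lia.
  have op : odd p by lia.
  have pn1 : (p.+1 < n)%N by lia.
  have pn2 : p.+2 == n by lia.
  by rewrite d hp op pn1 pn2.
have [pn1|np] := ltnP p.+1 n.
  case: (_ %| _)%N => /=; first by lia.
  rewrite andbT; case: (odd p) (low k p) => [] [] //=; rewrite andbT; lia.
have pnE : p.+1 = n by lia.
have op : odd p = false by lia.
have -> : p == n.-1 by lia.
have -> : low k n = low k p.+1 by rewrite pnE.
(* Here p = n-1 is even: if low, so is [n] and the last term counts the loss; if high, the term
   before it does. *)
rewrite op /=; move: (pe (negbT op)).
case: (low k p) => [->//|_] /=; lia.
Qed.

Lemma indep_num_petersen_ge n k (r := (n %% (2 * k))%N) :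
    odd n -> ~~ odd k -> (0 < k)%N -> (2 * k < n)%N ->
  (n + (r == 1) <=
   indep_num (@petersen n k) + n %/ (2 * k) + ((k - r) + (r - k)).+1./2)%N.
Proof.
move=> n_odd k_even k0 kn.
have le_alpha : (#|chosen n k| <= indep_num (@petersen n k))%N.
  by apply: leq_bigmax_cond; apply: chosen_independent => //; lia.
have tail := sum_high_even_tail n k n_odd k_even.
have := leq_trans _ (leq_add (leq_add le_alpha (leqnn _)) (tail _)).
apply; last by lia.
(* Every term becomes a sum over the subscripts, so that [chosen_or_lost] applies pointwise. *)
rewrite card_chosen -sum_dvd_succ -(sum_eq_nat (low k n) n.-1 n) ?addnA; last by lia.
rewrite -(sum_eq_nat (r == 1)%N (n - 2) n); last by lia.
rewrite -[X in (X + _ <= _)%N]subn0 -[X in (X + _ <= _)%N]muln1.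
rewrite -sum_nat_const_nat -!big_split /=.
rewrite big_nat_cond [X in (_ <= X)%N]big_nat_cond; apply: leq_sum => p /andP[pn _].
by apply: chosen_or_lost => //; lia.
Qed.

Theorem theorem3 (n k : nat) (n_odd : odd n) (k_gt2 : (2 < k)%N)
    (k_even : ~~ odd k) (n_gt : (2 * k < n)%N)
    (r : nat) (r_def : r = (n %% (2 * k))%N) :
  let alpha : rat := (indep_num (@petersen n k))%:R in
  let main : rat := (2 * k%:R - 1) * (n %/ (2 * k))%:R in
  [/\ (r = 1)%N ->
        alpha >= main + (- (k%:R / 2) + 2),
      (1 < r < k)%N ->
        alpha >= main + (3 * r%:R - k%:R - 1) / 2
    & (k < r < 2 * k)%N ->
        alpha >= main + (k%:R / 2 + (r%:R - 1) / 2)].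
Proof.
move=> alpha main; rewrite /alpha /main {alpha main}.
have := indep_num_petersen_ge n k n_odd k_even (ltnW (ltnW k_gt2)) n_gt.
have r_odd : odd r by rewrite r_def odd_mod // oddM.
have := divn_eq n (2 * k); rewrite -r_def.
move: (indep_num _) (n %/ _)%N => a q nE ge_a.
have nER : n%:R = q%:R * (2 * k%:R) + r%:R :> rat by rewrite {1}nE natrD !natrM.
split=> r_bnd.
(* In each case one truncated difference vanishes; doubling clears the halves before the cast to
   [rat]. *)
- have: (2 * n + 2 <= 2 * a + 2 * q + k)%N by lia.
  rewrite -(ler_nat rat) !(natrM, natrD) nER r_bnd; lra.
- have: (2 * n + r <= 2 * a + 2 * q + k + 1)%N by lia.
  rewrite -(ler_nat rat) !(natrM, natrD) nER; lra.
- have: (2 * n + k <= 2 * a + 2 * q + r + 1)%N by lia.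
  rewrite -(ler_nat rat) !(natrM, natrD) nER; lra.
Qed.
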